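(* Let $f : K^n \to K^m$ be an affine map and let $\mathcal{P}$ be a polyhedron in $K^n$. Then $f(\mathcal{P})$ is a polyhedron in $K^m$.
   Context: $(K,\mathrm{val})$ is a complete discretely valued field: $K$ is a field with a surjective valuation $\mathrm{val}: K \to \mathbb{Z}\cup\{+\infty\}$ (with $\mathrm{val}(x)=+\infty$ iff $x=0$), and $K$ is complete for the induced metric. A polyhedron in $K^n$ is a subset of the form $\{x \in K^n : \mathrm{val}(\ell_i(x)) \ge 0 \ (i=1,\dots,d),\ \mathrm{val}(m_j(x)) = +\infty \ (j=1,\dots,e)\}$ for some integers $d,e\ge 0$ and some polynomials $\ell_1,\dots,\ell_d,m_1,\dots,m_e \in K[x_1,\dots,x_n]$ of degree at most $1$. *)

(* Defs.v *)
From mathcomp Require Import all_boot all_order all_algebra.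
From mathcomp Require Import classical_sets constructive_ereal.
(* The notations of mpoly clash with those of classical_sets. *)
From mathcomp Require Import -(notations) mpoly.

Set Implicit Arguments.
Unset Strict Implicit.
Unset Printing Implicit Defensive.

Import Order.TTheory GRing.Theory Num.Theory.

Local Notation "{ 'mpoly' T [ n ] }" := (mpoly n T).

Local Open Scope classical_set_scope.
Local Open Scope ring_scope.

(* Surjective valuations K -> Z \cup {+oo}.  As \bar int also contains -oo,
   that value is excluded explicitly; +oo is always attained, at 0. *)
Record discrete_valuation (K : fieldType) (val : K -> \bar int) : Prop :=
  DiscreteValuation {
    val_neq_ninfty : forall x, val x <> -oo%E;
    val_eq_pinfty : forall x, val x = +oo%E <-> x = 0;
    val_mul : forall x y, val (x * y) = (val x + val y)%E;
    val_add : forall x y, (Order.min (val x) (val y) <= val (x + y)%R)%E;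
    val_surj : forall a : int, exists x, val x = a%:E }.

(* The metric 2 ^ (- val (x - y)), with 2 ^ (- oo) = 0.  Any other base > 1
   gives the same Cauchy and the same convergent sequences; with base 2 the
   metric is rational-valued. *)
Definition val_dist (K : fieldType) (val : K -> \bar int) (x y : K) : rat :=
  match val (x - y) with
  | EFin a => 2 ^ (- a)
  | _ => 0
  end.

Definition val_cauchy (K : fieldType) (val : K -> \bar int) (u : nat -> K) :=
  forall eps : rat, 0 < eps ->
  exists N, forall p q, (N <= p)%N -> (N <= q)%N ->
    val_dist val (u p) (u q) < eps.

Definition val_converges (K : fieldType) (val : K -> \bar int)
    (u : nat -> K) (x : K) :=
  forall eps : rat, 0 < eps ->
  exists N, forall p, (N <= p)%N -> val_dist val (u p) x < eps.

Definition val_complete (K : fieldType) (val : K -> \bar int) :=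
  forall u, val_cauchy val u -> exists x, val_converges val u x.

Definition affine_map (K : fieldType) (n m : nat)
    (f : 'rV[K]_n -> 'rV[K]_m) :=
  exists (g : {linear 'rV[K]_n -> 'rV[K]_m}) (b : 'rV[K]_m),
    forall x, f x = g x + b.

Definition mpoly_eval (K : fieldType) (n : nat) (p : {mpoly K[n]})
    (x : 'rV[K]_n) : K :=
  meval (x ord0) p.

(* msize p is 1 + the total degree of p, and 0 if p = 0. *)
Definition polyhedron (K : fieldType) (val : K -> \bar int) (n : nat)
    (P : set 'rV[K]_n) :=
  exists (d e : nat) (l : 'I_d -> {mpoly K[n]}) (m : 'I_e -> {mpoly K[n]}),
    [/\ forall i, (msize (l i) <= 2)%N,
        forall j, (msize (m j) <= 2)%N
      & P = [set x | (forall i, 0 <= val (mpoly_eval (l i) x))%E /\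
                     (forall j, val (mpoly_eval (m j) x) = +oo%E)]].

(* Main.v *)
Require Import Defs.
From mathcomp Require Import all_boot all_order all_algebra.
From mathcomp Require Import classical_sets constructive_ereal.
From mathcomp Require Import -(notations) mpoly.

Set Implicit Arguments.
Unset Strict Implicit.
Unset Printing Implicit Defensive.

Import Order.TTheory GRing.Theory Num.Theory.

Local Open Scope classical_set_scope.
Local Open Scope ring_scope.

(** The proof is a Fourier-Motzkin elimination which, over a valued field, does
    not multiply the inequalities. Write P as a system of conditions
    val (l_i x) >= 0 and m_j x = 0 with l_i, m_j affine, and let v be a vector.
    A point x lies in P + K v when some scalar t solves the system at x + t v.
    If an equation really involves t, it determines t. Otherwise each
    inequality involving t says that t lies in an ultrametric ball, of centre
    affine in x and of radius independent of x. Every point of a ball is a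
    centre of it, so balls meeting the smallest one contain it, and the balls
    have a common point exactly when the centre of the smallest one lies in all
    of them. In every case a single affine function t = t(x) is a solution
    whenever there is one ([polyhedron_add_line_section]), so P + K v is the
    preimage of P under the affine map x |-> x + t(x) v, hence a polyhedron
    ([polyhedron_add_line]).

    Adding lines one at a time, P + W is a polyhedron for every subspace W
    ([polyhedron_add_rowspace]). For f x = x A + b take W = ker A and let B be
    a partial inverse of A on its row space: y belongs to f(P) iff y - b is in
    the row space of A, which is a linear system in y, and (y - b) B belongs to
    P + ker A. *)

(** * Affine forms as polynomials of degree at most one *)

Lemma mpoly_eval_affine (K : fieldType) n (p : mpoly n K) :
  (msize p <= 2)%N ->
  exists (w : 'cV[K]_n) (c : K), forall x, mpoly_eval p x = (x *m w) 0 0 + c.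
Proof.
move=> hp; have: all (fun m => mdeg m <= 1)%N (msupp p).
  apply/allP => m /msize_mdeg_lt hm; rewrite -ltnS.
  exact: leq_trans hm hp.
suff /[apply] : all (fun m => mdeg m <= 1)%N (msupp p) ->
    exists (w : 'cV[K]_n) (c : K), forall x : 'rV_n,
      \sum_(m <- msupp p) mcoeff m p * \prod_i x ord0 i ^+ m i
        = (x *m w) 0 0 + c.
  by case=> w [c hwc]; exists w, c => x; rewrite /mpoly_eval mevalE.
elim: (msupp p) => [_ | m s IHs /= /andP[hm /IHs[w [c hwc]]]].
  by exists 0, 0 => x; rewrite big_nil mulmx0 mxE addr0.
have [m0 | m_neq0] := eqVneq (mdeg m) 0.
  move/eqP: m0; rewrite mdeg_eq0 => /eqP->.
  exists w, (mcoeff mnm0 p + c) => x; rewrite big_cons hwc.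
  rewrite big1 => [|i _]; last by rewrite mnm0E expr0.
  by rewrite mulr1 addrCA.
have /mdeg1P[i /eqP->] : mdeg m == 1 by rewrite eqn_leq hm lt0n.
exists (mcoeff (mnm1 i) p *: delta_mx i 0 + w), c => x.
rewrite big_cons hwc mulmxDr.
rewrite [in RHS]mxE -addrA; congr (_ + _).
rewrite -scalemxAr -colE !mxE; congr (_ * _).
rewrite (bigD1 i) //= big1 => [|j]; rewrite mnm1E ?eqxx ?expr1 ?mulr1 //.
by rewrite eq_sym => /negPf->.
Qed.

Lemma affine_mpoly_eval (K : fieldType) n (w : 'cV[K]_n) (c : K) :
  exists2 p : mpoly n K,
    (msize p <= 2)%N & forall x, mpoly_eval p x = (x *m w) 0 0 + c.
Proof.
exists (\sum_i w i 0 *: mpolyX K (mnm1 i) + mpolyC n c).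
  apply: leq_trans (msizeD_le _ _) _; rewrite geq_max msizeC.
  rewrite (leq_trans (leq_b1 _)) // andbT.
  apply: leq_trans (msize_sum _ _ _) _; apply/bigmax_leqP => i _.
  by apply: leq_trans (msizeZ_le _ _) _; rewrite msizeX mdeg1.
move=> x; rewrite /mpoly_eval mevalD mevalC raddf_sum mxE; congr (_ + _).
by apply: eq_bigr => i _; rewrite /= mevalZ mevalXU mulrC.
Qed.

(** * Polyhedra as affine systems *)

(** The matrix presentation of a polyhedron: column i of L and entry i of a
    give the affine form l_i, and likewise M, b for the equations. *)
Definition system_set (K : fieldType) (val : K -> \bar int) n d e
    (L : 'M[K]_(n, d)) (a : 'rV[K]_d) (M : 'M[K]_(n, e)) (b : 'rV[K]_e) :
    set 'rV[K]_n :=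
  [set x | (forall i, (0 <= val ((x *m L + a) ord0 i)%R)%E) /\ x *m M + b = 0].

Section Polyhedra.
Variables (K : fieldType) (val : K -> \bar int).
Hypothesis hval : discrete_valuation val.

Lemma val_1 : val 1 = 0%E.
Proof.
have := val_mul hval 1 1; rewrite mulr1.
have := @val_neq_ninfty _ _ hval 1; have := val_eq_pinfty hval 1.
case: (val 1) => [r _ _ [/eqP] | [/(_ erefl)/eqP] | _ /(_ erefl)] //.
  by rewrite -[X in X == _]addr0 (inj_eq (addrI r)) => /eqP<-.
by rewrite oner_eq0.
Qed.

Lemma valN x : val (- x) = val x.
Proof.
have: val (- 1) = 0%E.
  have := val_mul hval (- 1) (- 1); rewrite mulrNN mulr1 val_1.
  by case: (val (- 1)) => [r||] //= [/eqP]; rewrite -mulr2n eq_sym mulrn_eq0 => /eqP->.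
by move=> v1; rewrite -mulN1r (val_mul hval) v1 add0e.
Qed.

(** The integers of [val] are closed under the combination by which a pivot
    inequality is subtracted from another one. *)
Lemma val_ge0_sub_mul u v q :
  (0 <= val u -> 0 <= val v -> 0 <= val q -> 0 <= val (u - v * q)%R)%E.
Proof.
move=> hu hv hq; apply: le_trans (val_add hval _ _).
by rewrite le_min hu valN (val_mul hval) adde_ge0.
Qed.

Lemma val_div_ge0 x y : y != 0 -> (val y <= val x)%E -> (0 <= val (x / y)%R)%E.
Proof.
move=> y0; have := val_mul hval (x / y) y; rewrite divfK // => ->.
have := @val_neq_ninfty _ _ hval y; have := proj1 (val_eq_pinfty hval y).
case: (val y) => [r _ _ | /(_ erefl)/eqP | _ /(_ erefl)] //.
  by case: (val (x / y)) => [s||] //=; rewrite -EFinD !lee_fin lerDr.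
by rewrite (negPf y0).
Qed.

Lemma polyhedronP n (P : set 'rV[K]_n) :
  polyhedron val P <->
  exists d e L a M b, P = @system_set K val n d e L a M b.
Proof.
split=> [[d [e [l [m [hl hm ->]]]]] | [d [e [L [a [M [b ->]]]]]]].
  have [w hw] := fin_all_exists (fun i => mpoly_eval_affine (hl i)).
  have [c hc] := fin_all_exists hw.
  have [w' hw'] := fin_all_exists (fun i => mpoly_eval_affine (hm i)).
  have [c' hc'] := fin_all_exists hw'.
  exists d, e, (\matrix_(i, j) w j i 0), (\row_j c j),
    (\matrix_(i, j) w' j i 0), (\row_j c' j).
  have E k (u : 'I_k -> 'cV[K]_n) (r : 'I_k -> K) (x : 'rV_n) j :
    (x *m (\matrix_(i, j) u j i 0) + \row_j r j) ord0 j = (x *m u j) 0 0 + r j.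
    by rewrite !mxE; congr (_ + _); apply: eq_bigr => i _; rewrite mxE.
  apply/seteqP; split=> x [hx hx']; split=> [i|]; rewrite ?E -?hc //.
  - by apply/rowP => j; rewrite E -hc' mxE; apply/(val_eq_pinfty hval).
  - by have := hx i; rewrite E -hc.
  - by move=> j; apply/(val_eq_pinfty hval); rewrite hc' -E hx' mxE.
have [l hl hl'] := fin_all_exists2
  (fun i => affine_mpoly_eval (col i L) (a 0 i)).
have [m hm hm'] := fin_all_exists2
  (fun i => affine_mpoly_eval (col i M) (b 0 i)).
have E k (A : 'M[K]_(n, k)) (r : 'rV[K]_k) (x : 'rV_n) j :
  (x *m col j A) 0 0 + r 0 j = (x *m A + r) ord0 j.
  by rewrite !mxE; congr (_ + _); apply: eq_bigr => i _; rewrite mxE.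
exists d, e, l, m; split=> //.
apply/seteqP; split=> x [hx hx']; split=> [i|].
- by rewrite hl' E.
- by move=> j; apply/(val_eq_pinfty hval); rewrite hm' E hx' mxE.
- by rewrite -E -hl'.
- by apply/rowP => j; rewrite -E -hm' mxE; apply/(val_eq_pinfty hval).
Qed.

Lemma polyhedron_preimage n k (A : 'M[K]_(k, n)) (c : 'rV[K]_n)
    (P : set 'rV[K]_n) :
  polyhedron val P -> polyhedron val [set x : 'rV_k | P (x *m A + c)].
Proof.
move=> /polyhedronP[d [e [L [a [M [b ->]]]]]]; apply/polyhedronP.
exists d, e, (A *m L), (c *m L + a), (A *m M), (c *m M + b).
by apply/seteqP; split=> x /=; rewrite /system_set /= !mulmxDl -!mulmxA -!addrA.
Qed.

Lemma polyhedron_setI_affine n k (A : 'M[K]_(n, k)) (c : 'rV[K]_k)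
    (P : set 'rV[K]_n) :
  polyhedron val P -> polyhedron val [set x | x *m A + c = 0 /\ P x].
Proof.
move=> /polyhedronP[d [e [L [a [M [b ->]]]]]]; apply/polyhedronP.
exists d, (k + e)%N, L, a, (row_mx A M), (row_mx c b).
apply/seteqP; split=> x /=; rewrite /system_set /= mul_mx_row add_row_mx.
  by case=> -> [hx ->]; rewrite row_mx0.
by rewrite -(row_mx0 K 1 k e); case=> hx /eq_row_mx[].
Qed.

(** * Eliminating one direction *)

(** The heart of the elimination: the parameter t can be chosen as an affine
    function of x. The inequality used as pivot is the one whose coefficient
    along v is nonzero of least valuation, that is, whose ball of admissible t
    has the smallest radius. *)
Lemma polyhedron_add_line_section n (P : set 'rV[K]_n) (v : 'rV[K]_n) :
  polyhedron val P ->
  exists (w : 'cV[K]_n) (c : K),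
    forall x t, P (x + t *: v) -> P (x - ((x *m w) 0 0 + c) *: v).
Proof.
move=> /polyhedronP[d [e [L [a [M [b ->]]]]]].
have shift k (A : 'M[K]_(n, k)) (r : 'rV[K]_k) x t i :
    ((x + t *: v) *m A + r) ord0 i = (x *m A + r) 0 i + t * (v *m A) 0 i.
  by rewrite mulmxDl -scalemxAl addrAC mxE; congr (_ + _); rewrite mxE.
have tau k (A : 'M[K]_(n, k)) (r : 'rV[K]_k) (s : K) j :
  exists (w : 'cV[K]_n) (c : K), forall x : 'rV_n,
    (x *m w) 0 0 + c = (x *m A + r) 0 j / s.
  exists (s^-1 *: col j A), (r 0 j / s) => x.
  rewrite -scalemxAr mxE mulrC -mulrDl; congr (_ / _).
  by rewrite !mxE; congr (_ + _); apply: eq_bigr => i _; rewrite mxE.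
(* An equation involving t leaves only one possible value of t. *)
have [vM0 | /rV0Pn[j vj]] := eqVneq (v *m M) 0; last first.
  have [w [c hwc]] := tau e M b ((v *m M) 0 j) j.
  exists w, c => x t Px; have [_ /rowP/(_ j)] := Px; rewrite shift [RHS]mxE => Ej.
  rewrite -scaleNr; suff -> : - ((x *m w) 0 0 + c) = t by [].

  by rewrite hwc (canRL (addrK _) Ej) sub0r mulNr opprK mulfK.
have eqM x t : (x + t *: v) *m M + b = x *m M + b.
  by rewrite mulmxDl -scalemxAl vM0 scaler0 addr0.
(* If t occurs nowhere, t = 0 will do. *)
have [vL0 | /rV0Pn[i0 vi0]] := eqVneq (v *m L) 0.
  exists 0, 0 => x t [hx hx']; rewrite mulmx0 mxE addr0 scale0r subr0.
  split=> [i|]; last by rewrite -(eqM x t).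
  by have := hx i; rewrite shift vL0 [X in _ * X]mxE mulr0 addr0.
case: (@arg_minP _ _ _ i0 (fun i => (v *m L) 0 i != 0)
  (fun i => val ((v *m L) 0 i)) vi0) => k vk min_k.
have [w [c hwc]] := tau d L a ((v *m L) 0 k) k.
exists w, c => x t [hx hx']; split=> [i|]; last by rewrite -scaleNr eqM -(eqM x t).
rewrite -scaleNr shift hwc.
set y := x *m L + a; set z := v *m L.
(* At t(x) the pivot form vanishes, so the i-th form there is its value at the
   given t, minus the value of the pivot form at t times the ratio of the two
   coefficients, which is an integer by the choice of k. *)
have -> : y 0 i + - (y 0 k / z 0 k) * z 0 i =
    (y 0 i + t * z 0 i) - (y 0 k + t * z 0 k) * (z 0 i / z 0 k).
  rewrite mulrDl -[t * z 0 k * _]mulrA [z 0 k * _]mulrC divfK //.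
  by rewrite opprD addrACA addrN addr0 mulNr mulrA mulrAC.
apply: val_ge0_sub_mul; rewrite -?shift //.
have [-> | zi] := eqVneq (z 0 i) 0; last by apply: val_div_ge0 => //; exact: min_k.
by rewrite mul0r (proj2 (val_eq_pinfty hval 0)).
Qed.

Lemma polyhedron_add_line n (P : set 'rV[K]_n) (v : 'rV[K]_n) :
  polyhedron val P -> polyhedron val [set x | exists t, P (x + t *: v)].
Proof.
move=> hP; have [w [c hwc]] := polyhedron_add_line_section v hP.
have E x : x - ((x *m w) 0 0 + c) *: v = x *m (1%:M - w *m v) + - (c *: v).
  rewrite mulmxBr mulmx1 mulmxA -addrA -opprD scalerDl.
  by rewrite [x *m w in RHS]mx11_scalar mul_scalar_mx.
suff -> : [set x | exists t, P (x + t *: v)] =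
    [set x | P (x *m (1%:M - w *m v) + - (c *: v))] by exact: polyhedron_preimage.
apply/seteqP; split=> x /=; rewrite -E; first by case=> t /hwc.
by rewrite -scaleNr => Px; eexists; exact: Px.
Qed.

(** * Adding a subspace *)

Lemma polyhedron_add_rowspace n r (A : 'M[K]_(r, n)) (P : set 'rV[K]_n) :
  polyhedron val P ->
  polyhedron val [set x | exists w : 'rV_r, P (x + w *m A)].
Proof.
elim: r A P => [|r IHr] A P hP.
  suff -> : [set x | exists w : 'rV_0, P (x + w *m A)] = P by [].
  apply/seteqP; split=> x /=.
    by case=> w; rewrite thinmx0 mul0mx addr0.
  by move=> Px; exists 0; rewrite mul0mx addr0.
pose u := usubmx (A : 'M_(1 + r, n)); pose D := dsubmx (A : 'M_(1 + r, n)).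
have E (w : 'rV_(1 + r)) : w *m A = lsubmx w 0 0 *: u + rsubmx w *m D.
  by rewrite -mul_scalar_mx -mx11_scalar -mul_row_col hsubmxK vsubmxK.
have := IHr D _ (polyhedron_add_line u hP).
congr polyhedron; apply/seteqP; split=> x /=.
  case=> w [t Px]; exists (row_mx t%:M w : 'rV_(1 + r)).
  by rewrite E row_mxKl row_mxKr mxE eqxx mulr1n addrA addrAC.
case=> w; rewrite E => Px.
by exists (rsubmx (w : 'rV_(1 + r))), (lsubmx (w : 'rV_(1 + r)) 0 0);
  rewrite -addrA [X in x + X]addrC.
Qed.

End Polyhedra.

Theorem theorem1p1 (K : fieldType) (val : K -> \bar int)
  (hval : discrete_valuation val) (hK : val_complete val)
  (n m : nat) (f : 'rV[K]_n -> 'rV[K]_m) (hf : affine_map f)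
  (P : set 'rV[K]_n) (hP : polyhedron val P) :
  polyhedron val (f @` P).
Proof.
case: hf => g [b hfE]; pose A := lin1_mx g.
have fE x : f x = x *m A + b by rewrite hfE mul_rV_lin1.
(* cokermx A cuts out the row space of A, on which pinvmx A is a section of
   x |-> x *m A; two preimages of a point differ by an element of kermx A. *)
have := polyhedron_setI_affine hval (cokermx A) (- b *m cokermx A)
  (polyhedron_preimage hval (pinvmx A) (- b *m pinvmx A)
     (polyhedron_add_rowspace hval (kermx A) hP)).
congr polyhedron; apply/seteqP; split=> y /=.
  rewrite -!mulmxDl => -[/eqP]; rewrite -submxE => ybA [w Pw].
  eexists; first exact: Pw.
  by rewrite fE mulmxDl mulmxKpV // -mulmxA mulmx_ker mulmx0 addr0 addrNK.
case=> x Px <-; rewrite -!mulmxDl fE addrK -mulmxA mulmx_coker mulmx0.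
split=> //.
have /sub_kermxP/submxP[w hw] : (x - x *m A *m pinvmx A) *m A = 0.
  by rewrite mulmxBl mulmxKpV ?submxMl // subrr.
by exists w; rewrite -hw addrC addrNK.
Qed.
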